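(* For graphs $G$ on $n$ vertices, as $n\to\infty$, $$\chi^\star_\ell(G) \le (5+o(1))\,\rho(G)\,(\log n)^2 .$$
   Context: Graphs are finite and simple; $\log$ is the natural logarithm. The $o(1)$ term depends only on $n$: for every $\varepsilon>0$ there is $n_0$ such that the inequality holds with $5+\varepsilon$ in place of $5+o(1)$ for every graph on $n\ge n_0$ vertices. The Hall ratio of $G$ is $\rho(G)=\max_{H\subseteq G}|H|/\alpha(H)$, where the maximum is over subgraphs $H$ of $G$ containing at least one vertex, $|H|$ is the number of vertices of $H$ and $\alpha(H)$ is the size of a largest independent set in $H$. A list-assignment $L$ of $G$ maps each vertex $v\in V(G)$ to a set $L(v)\subseteq\mathbb{N}$ of colours; it is a $k$-list-assignment if $|L(v)|=k$ for every $v$. A proper $L$-colouring is a map $c:V(G)\to\mathbb{N}$ with $c(v)\in L(v)$ for all $v$ and $c(u)\neq c(v)$ for every edge $uv$. A proper $L$-packing of $G$ of size $k$ is a collection of $k$ proper $L$-colourings $c_1,\dots,c_k$ that are mutually disjoint, i.e. $c_i(v)\neq c_j(v)$ for all $i\neq j$ and all $v\in V(G)$. The list packing number $\chi^\star_\ell(G)$ is the least $k$ such that $G$ admits a proper $L$-packing of size $k$ for every $k$-list-assignment $L$ of $G$. *)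

(* Defs.v *)
From mathcomp Require Import all_boot all_order all_algebra all_fingroup.
From mathcomp Require Import finmap.
From mathcomp Require Import boolp.

Set Implicit Arguments.
Unset Strict Implicit.
Unset Printing Implicit Defensive.

Import Order.TTheory GRing.Theory Num.Theory.

Record sgraph := SGraph {
  vertex :> finType;
  edge : rel vertex;
  edge_sym : symmetric edge;
  edge_irrefl : irreflexive edge }.

(* A subgraph of G, not necessarily induced, is encoded as a pair of a vertex
   set and a set of edges, each edge xy occurring as both (x, y) and (y, x). *)
Definition is_subgraph (G : sgraph) (H : {set G} * {set G * G}) : bool :=
  [forall x, forall y, ((x, y) \in H.2) ==>
     [&& x \in H.1, y \in H.1, edge x y & (y, x) \in H.2]].

Definition independent_in (G : sgraph) (H : {set G} * {set G * G})
    (I : {set G}) : bool :=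
  (I \subset H.1) && [forall x in I, forall y in I, (x, y) \notin H.2].

Definition alpha (G : sgraph) (H : {set G} * {set G * G}) : nat :=
  \max_(I : {set G} | independent_in H I) #|I|.

(* The default value 0 only matters for the graph without vertices: every
   ratio in the maximum is positive. *)
Definition hall_ratio (R : realFieldType) (G : sgraph) : R :=
  (\big[Num.max/0]_(H : {set G} * {set G * G} |
      is_subgraph H && (H.1 != set0)) (#|H.1|%:R / (alpha H)%:R))%R.

Definition list_assignment (G : sgraph) (k : nat) (L : G -> {fset nat}) : Prop :=
  forall v, #|` L v| = k.

Definition proper_list_colouring (G : sgraph) (L : G -> {fset nat})
    (c : G -> nat) : Prop :=
  (forall v, c v \in L v) /\ (forall u v, edge u v -> c u != c v).

Definition proper_list_packing (G : sgraph) (L : G -> {fset nat}) (k : nat)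
    (c : 'I_k -> G -> nat) : Prop :=
  (forall i, proper_list_colouring L (c i)) /\
  (forall i j v, i != j -> c i v != c j v).

Definition list_packable (G : sgraph) (k : nat) : Prop :=
  forall L : G -> {fset nat}, list_assignment k L ->
    exists c : 'I_k -> G -> nat, proper_list_packing L c.

Lemma card_bigcup_le1 (I T : finType) (A : I -> {set T}) :
  (forall i, #|A i| <= 1) -> #|\bigcup_i A i| <= #|I|.
Proof.
move=> A1; rewrite -[X in _ <= X]sum1_card.
elim/big_rec2: _ => [|i m B _ leBm]; first by rewrite cards0.
exact: leq_trans (leq_card_setU _ _) (leq_add (A1 i) leBm).
Qed.

(* A permutation with the fewest conflicts has none: otherwise a conflict can
   be removed by exchanging two values. *)
Lemma perm_avoiding (k d : nat) (F : rel 'I_k) :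
  d.*2 < k ->
  (forall i, #|[set j | F i j]| <= d) ->
  (forall j, #|[set i | F i j]| <= d) ->
  exists s : {perm 'I_k}, forall i, ~~ F i (s i).
Proof.
move=> ltdk Fl Fr.
pose bad (s : {perm 'I_k}) := [set i | F i (s i)].
pose s := [arg min_(s < (1%g : {perm 'I_k})) #|bad s|].
have smin t : #|bad s| <= #|bad t|.
  by rewrite /s; case: arg_minnP => // s' _; apply.
exists s => i; apply/negP => Fi.
pose B := (s @^-1: [set j | F i j]) :|: [set j | F j (s i)].
have /card_gt0P [j] : 0 < #|~: B|.
  rewrite cardsCs setCK card_ord subn_gt0.
  apply: leq_ltn_trans ltdk; rewrite -addnn.
  apply: leq_trans (leq_card_setU _ _) (leq_add _ (Fr _)).
  by rewrite card_preimset //; exact: perm_inj.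
rewrite !inE negb_or => /andP [Fij Fji].
suff /proper_card : bad (tperm i j * s)%g \proper bad s by rewrite ltnNge smin.
apply/properP; split; last first.
  by exists i; rewrite inE // permM tpermL.
apply/subsetP => l; rewrite !inE permM.
by case: tpermP => [->|->|//]; rewrite ?(negbTE Fij) ?(negbTE Fji).
Qed.

Lemma list_packable_large (G : sgraph) : list_packable G (#|G|.*2.+1).
Proof.
move=> L; set k := _.+1 => Lk.
have g_inj v : injective (fun j : 'I_k => nth 0 (L v) j).
  move=> i j /eqP; rewrite nth_uniq ?fset_uniq ?Lk //.
  by move/eqP/val_inj.
have [c [cL cI cP]] : exists c : 'I_k -> G -> nat,
  [/\ forall i v, v \in enum G -> c i v \in L v,
      forall i j v, v \in enum G -> i != j -> c i v != c j v &
      forall i u v, u \in enum G -> v \in enum G -> edge u v ->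
        c i u != c i v].
  elim: (enum G) => [|v s [c [cL cI cP]]]; first by exists (fun _ _ => 0).
  pose F (i j : 'I_k) := [exists (u | u \in s), c i u == nth 0 (L v) j].
  have [|i|j|p Fp] := @perm_avoiding k #|G| F.
  - by rewrite /k.
  - apply: leq_trans (card_bigcup_le1
      (A := fun u => [set j : 'I_k | c i u == nth 0 (L v) j]) _).
      apply/subset_leq_card/subsetP => j; rewrite inE => /exists_inP [u us cu].
      by apply/bigcupP; exists u => //; rewrite inE.
    move=> u; apply/card_le1_eqP => a b; rewrite !inE => /eqP ca /eqP cb.
    by apply: (g_inj v); rewrite -ca -cb.
  - apply: leq_trans (card_bigcup_le1
      (A := fun u => [set i : 'I_k | (u \in s) && (c i u == nth 0 (L v) j)]) _).
      apply/subset_leq_card/subsetP => i; rewrite inE => /exists_inP [u us cu].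
      by apply/bigcupP; exists u => //; rewrite inE us.
    move=> u; apply/card_le1_eqP => a b; rewrite !inE.
    move=> /andP [us /eqP ca] /andP [_ /eqP cb]; apply/eqP.
    by apply: contraT => /(cI _ _ _ us); rewrite ca cb eqxx.
  have av i u : u \in s -> c i u != nth 0 (L v) (p i).
    move=> us; apply: contraNneq (Fp i) => cu.
    by apply/exists_inP; exists u => //; rewrite cu.
  exists (fun i u => if u == v then nth 0 (L v) (p i) else c i u); split.
  - move=> i u; rewrite inE; case: eqP => [->|_ /=] // => [_|]; last exact: cL.
    by rewrite mem_nth // Lk.
  - move=> i j u; rewrite inE; case: eqP => [_ _|_ /=]; last exact: cI.
    by apply: contraNneq => /(g_inj v) /perm_inj ->.
  - move=> i u w; rewrite !inE; case: eqP => [->|_] /=; case: eqP => [->|_] /=.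
    + by rewrite edge_irrefl.
    + by move=> _ ws _; rewrite eq_sym av.
    + by move=> us _ _; rewrite av.
    + exact: cP.
exists c; split=> [i|i j v]; last by apply: cI; rewrite mem_enum.
by split=> [v|u v]; [apply: cL | apply: cP]; rewrite mem_enum.
Qed.

Lemma list_packable_exists (G : sgraph) :
  exists k : nat, (0 < k) && `[< list_packable G k >].
Proof. by exists (#|G|.*2.+1); apply/asboolP/list_packable_large. Qed.

(* The minimum is over positive k: list_packable G 0 holds vacuously. *)
Definition list_packing_number (G : sgraph) : nat :=
  ex_minn (list_packable_exists G).

(* Main.v *)
Require Import Defs.
From mathcomp Require Import all_boot all_order all_algebra.
From mathcomp Require Import reals exp.
From mathcomp Require Import finmap sequences zify ring lra.

(** Write rho for the Hall ratio, n for the number of vertices and l = ln n.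

    Every vertex set U contains an independent set of size at least |U| / rho.
    Removing such sets greedily divides the vertices left over by at least
    1 / (1 - 1/rho) each time, so that any r > rho * l steps use up all n
    vertices: G has a proper colouring by r classes, with r about rho * l
    ([proper_colouring_hall_ratio]).

    Fix k-element lists. For each index i < k of a colouring of the packing and
    each colour c, choose a class f (i, c) uniformly and independently, and let
    the i-th colouring use c only on vertices of the class f (i, c). Each of the
    k colourings is then automatically proper, and a packing exists as soon as,
    at every vertex v, the k indices can be matched perfectly with the k colours
    of L v along the pairs (i, c) such that f (i, c) is the class of v. These
    pairs form a random bipartite graph in which each edge is present with
    probability 1/r. By the Frobenius-Koenig form of Hall's theorem
    ([frobenius_konig]), a perfect matching fails to exist only if there is an
    empty a x b rectangle with a + b = k + 1. With q = 1 - 1/r, the expected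
    number of such rectangles is the sum of C(k,a) C(k,b) q^(ab). When
    k^4 q^(k-1) <= 1, each of the k terms is at most the term k q^k of the
    isolated vertices, a = 1 or b = 1 ([rectangle_term_le]), so the sum is at
    most k^2 q^k. If moreover n k^2 q^k < 1, then some f is good for all
    vertices at once ([list_packable_of_colouring]).

    For k about 5 rho l^2, the ratio k / r is about 5 l, so that q^(k-1) is at
    most n^(-9/2) once n is large. Since 2n + 1 colours always suffice
    ([list_packable_large]), only k <= 2n matters, and then both conditions
    hold with room to spare: k^4 and n k^2 are at most 16 n^4 and 4 n^3. *)

Set Implicit Arguments.
Unset Strict Implicit.
Unset Printing Implicit Defensive.

Import Order.TTheory GRing.Theory Num.Theory.
Local Open Scope ring_scope.

(** * Matchings in bipartite graphs *)

(** Rado's proof of Hall's theorem: if some N x has two elements y1 and y2, one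
    of them can be deleted from N x without spoiling the condition. Otherwise
    A1 and A2, both without x, violate it together with x after the deletion of
    y1 and of y2 respectively, and submodularity of the size of neighbourhoods
    produces a violation of the original condition at x |: (A1 :|: A2) or at
    A1 :&: A2. Once every N x is a singleton, the condition is injectivity. *)
Lemma hall_matching (X Y : finType) (N : X -> {set Y}) :
    (forall A : {set X}, #|A| <= #|\bigcup_(x in A) N x|)%N ->
  exists2 s : X -> Y, injective s & forall x, s x \in N x.
Proof.
have [m] := ubnP (\sum_x #|N x|)%N; elim: m N => // m IH N leNm hallN.
have [/existsP[x /card_gt1P[y1 [y2 [y1x y2x neq_y]]]] | small] :=
    boolP [exists x, 1 < #|N x|]%N; last first.
  have N1 x : #|N x| = 1%N.
    apply/eqP; rewrite eqn_leq leqNgt; apply/andP; split.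
      by apply: contra small => gt1; apply/existsP; exists x.
    by have := hallN [set x]; rewrite big_set1 cards1.
  have [s sN] : exists s : X -> Y, forall x, s x \in N x.
    suff /fin_all_exists : forall x, exists y, y \in N x by [].
    by move=> x; apply/set0Pn; rewrite -card_gt0 N1.
  exists s => // x x' eq_s; apply/eqP; apply: contraT => neq_x.
  have := hallN [set x; x']; rewrite cards2 neq_x big_setU1 ?inE //= big_set1.
  have NE z : N z = [set s z].
    by apply/esym/eqP; rewrite eqEcard sub1set sN cards1 N1.
  by rewrite !NE eq_s setUid cards1.
pose del y z := if z == x then N z :\ y else N z.
have delN y z : del y z \subset N z.
  by rewrite /del; case: eqP => // _; apply: subD1set.
have shrink y : y \in N x ->
    (forall A : {set X}, #|A| <= #|\bigcup_(z in A) del y z|)%N ->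
  exists2 s : X -> Y, injective s & forall z, s z \in N z.
  move=> yx hally; have [|s s_inj sN] := IH (del y) _ hally.
    move: leNm; rewrite ltnS; apply: leq_trans.
    rewrite (bigD1 x) //= [ltnRHS](bigD1 x) //=.
    rewrite {1}/del eqxx [in ltnRHS](cardsD1 y) yx add1n addSn ltnS leq_add2l.
    by apply: leq_sum => z _; apply/subset_leq_card/delN.
  by exists s => // z; apply: subsetP (delN y z) _ (sN z).
have violator y : ~~ [forall A : {set X}, #|A| <= #|\bigcup_(z in A) del y z|]%N ->
  exists2 A : {set X}, x \notin A &
    (#|(N x :\ y) :|: \bigcup_(z in A) N z| <= #|A|)%N.
  case/forallPn => A; rewrite -ltnNge => ltA.
  have eq_out (B : {set X}) : x \notin B ->
      \bigcup_(z in B) del y z = \bigcup_(z in B) N z.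
    move=> xB; apply: eq_bigr => z zB; rewrite /del.
    by case: eqP zB => // ->; rewrite (negPf xB).
  have [xA | xA] := boolP (x \in A); last first.
    by move: ltA; rewrite eq_out // ltnNge hallN.
  exists (A :\ x); first by rewrite !inE eqxx.
  move: ltA; rewrite (big_setD1 x) //= eq_out ?inE ?eqxx //.
  by rewrite {1}/del eqxx [in X in (_ < X)%N -> _](cardsD1 x) xA add1n ltnS.
have [/forallP | /violator[A1 xA1 leA1]] :=
  boolP [forall A : {set X}, #|A| <= #|\bigcup_(z in A) del y1 z|]%N.
  exact: shrink.
have [/forallP | /violator[A2 xA2 leA2]] :=
  boolP [forall A : {set X}, #|A| <= #|\bigcup_(z in A) del y2 z|]%N.
  exact: shrink.
(* The left sides union to the neighbourhood of x |: (A1 :|: A2), as y1 and y2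
   are distinct, and their intersection contains that of A1 :&: A2. *)
have := leq_add leA1 leA2; rewrite leqNgt => /negP[].
rewrite -cardsUI -[ltnRHS]cardsUI addnC -addnS addnC.
apply: leq_add.
  apply: leq_trans (_ : #|x |: (A1 :|: A2)| <= _)%N.
    by rewrite cardsU1 !inE negb_or xA1 xA2.
  apply: leq_trans (hallN _) (subset_leq_card _).
  apply/subsetP => y /bigcupP[z]; rewrite !inE => /or3P[/eqP->|zA|zA] yz.
  - rewrite yz !andbT; have [->|] := eqVneq y y1; last by [].
    by rewrite neq_y !orbT.
  - have -> : y \in \bigcup_(z in A1) N z by apply/bigcupP; exists z.
    by rewrite orbT.
  - have -> : y \in \bigcup_(z in A2) N z by apply/bigcupP; exists z.
    by rewrite !orbT.
apply: leq_trans (hallN _) (subset_leq_card _).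
apply/subsetP => y /bigcupP[z]; rewrite !inE => /andP[z1 z2] yz.
by apply/andP; split; apply/orP; right; apply/bigcupP; exists z.
Qed.

(** A Hall violator A has at least k + 1 - |A| non-neighbours. Fixing the total
    |A| + |B| at k + 1 exactly keeps the number of rectangles to be excluded
    small enough for a union bound. *)
Lemma frobenius_konig (k : nat) (E : 'I_k -> 'I_k -> bool) :
    (forall A B : {set 'I_k}, (#|A| + #|B| = k.+1)%N ->
      [exists i in A, exists j in B, E i j]) ->
  exists2 s : 'I_k -> 'I_k, injective s & forall i, E i (s i).
Proof.
move=> noRect; have [A|s s_inj sN] := @hall_matching _ _ (fun i => [set j | E i j]).
  rewrite leqNgt; apply/negP; set NA := \bigcup_(i in A) _ => ltA.
  have card_le_k (S : {set 'I_k}) : (#|S| <= k)%N.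
    by have := max_card (mem S); rewrite card_ord.
  have: (0 < 'C(#|~: NA|, k.+1 - #|A|))%N.
    rewrite bin_gt0 leq_subLR (cardsCs (~: NA)) setCK card_ord.
    by move: ltA (card_le_k NA); rewrite -/NA; lia.
  rewrite -cards_draws card_gt0 => /set0Pn[B]; rewrite inE => /andP[BN /eqP cB].
  have /exists_inP[i iA /exists_inP[j jB Eij]] : [exists i in A, exists j in B, E i j].
    by apply: noRect; rewrite cB subnKC // ltnW // ltnS.
  move/subsetP/(_ j jB): BN; rewrite inE => /negP[].
  by apply/bigcupP; exists i => //; rewrite inE.
by exists s => // i; have := sN i; rewrite inE.
Qed.

(** * Counting empty rectangles *)

(** The probability that a uniformly random f : X -> 'I_r avoids y on S is
    (1 - 1/r) ^ |S|; the number of functions is used in place of a probability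
    measure. *)
Lemma card_ffun_avoiding (R : numFieldType) (X : finType) (r : nat)
    (S : {set X}) (y : 'I_r) :
  #|[set f : {ffun X -> 'I_r} | [forall x in S, f x != y]]|%:R
    = r%:R ^+ #|X| * (1 - r%:R^-1) ^+ #|S| :> R.
Proof.
have r_gt0 : (0 < r)%N by case: r y => [[]|].
have rR0 : r%:R != 0 :> R by rewrite pnatr_eq0 -lt0n.
pose F (x : X) : pred 'I_r := [pred z | (x \in S) ==> (z != y)].
have -> : #|[set f : {ffun X -> 'I_r} | [forall x in S, f x != y]]|
    = #|(family F : simpl_pred _)|.
  apply: eq_card => f; rewrite inE; apply/forallP/familyP => avoid x.
    exact: avoid x.
  exact: avoid x.
rewrite card_family foldrE big_map big_enum /= natr_prod.
rewrite (eq_bigr (fun x => r%:R * (if x \in S then 1 - r%:R^-1 else 1))); last first.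
  move=> x _; rewrite /F; case: (x \in S) => /=.
    have -> : #|[pred z | z != y]| = r.-1.
      by have := cardC1 y; rewrite card_ord => <-; apply: eq_card.
    by rewrite -subn1 natrB // mulrBr mulr1 mulfV.
  by rewrite mulr1 -[in RHS](card_ord r); congr _%:R; apply: eq_card.
by rewrite big_split /= prodr_const -big_mkcond /= prodr_const.
Qed.

Lemma bin_le_expn (n m : nat) : ('C(n, m) <= n ^ m)%N.
Proof.
elim: n m => [|n IH] [|m]; rewrite ?bin0 ?bin0n ?expn0 //.
rewrite binS (leq_trans (leq_add (IH _) (IH _))) //.
rewrite expnSr addnC -mulnS [leqRHS]expnSr leq_mul2r.
by case: m => // m; rewrite leq_exp2r ?leqnSn ?orbT.
Qed.

(** By symmetry let a <= b and put m = a - 1. Then 'C(k, a) * 'C(k, b) is at most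
    k ^ (2m + 1) and a * b = k + m * (k - a), so the left side is at most
    (k q^k) * (k^2 q^(k-a))^m. Since 2 (k - a) >= k - 1, the square of
    k^2 q^(k-a) is bounded by k^4 q^(k-1). *)
Lemma rectangle_term_le (R : realFieldType) (q : R) (k a b : nat) :
    0 <= q <= 1 -> k%:R ^+ 4 * q ^+ k.-1 <= 1 ->
    (0 < a)%N -> (0 < b)%N -> (a + b = k.+1)%N ->
  ('C(k, a) * 'C(k, b))%:R * q ^+ (a * b) <= k%:R * q ^+ k.
Proof.
move=> /andP[q0 q1] small.
wlog leab : a b / (a <= b)%N.
  move=> hw a0 b0 abk; have [/hw|/ltnW/hw] := leqP a b; first by apply.
  by rewrite (mulnC b) (mulnC 'C(k, b)); apply=> //; rewrite addnC.
case: a leab => // m leab _ b0 [abk].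
have -> : 'C(k, b) = 'C(k, m).
  by rewrite -(bin_sub (n := k) (m := b)) -abk ?leq_addl // addnK.
have lt2mk : (m.*2 < k)%N by rewrite -addnn -addnS -abk leq_add2l.
have -> : (m.+1 * b = k + (k - m.+1) * m)%N.
  have -> : (k - m.+1 = b.-1)%N by rewrite -abk -[in LHS](prednK b0) addnS subSS addKn.
  by rewrite -abk -{1 2}(prednK b0); lia.
rewrite exprD exprM.
apply: le_trans (_ : (k%:R * q ^+ k) * (k%:R ^+ 2 * q ^+ (k - m.+1)) ^+ m <= _).
  rewrite exprMn (mulrACA k%:R) ler_wpM2r ?mulr_ge0 ?exprn_ge0 //.
  rewrite -exprM -exprS -natrX ler_nat.
  have -> : ((2 * m).+1 = m.+1 + m)%N by lia.
  by rewrite expnD leq_mul // bin_le_expn.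
rewrite -[leRHS]mulr1 ler_wpM2l ?mulr_ge0 ?exprn_ge0 ?ler0n //.
have base_ge0 : 0 <= k%:R ^+ 2 * q ^+ (k - m.+1) by rewrite mulr_ge0 ?exprn_ge0 ?ler0n.
rewrite exprn_ile1 // -(expr_le1 (n := 2)) // exprMn -!exprM.
apply: le_trans small; rewrite ler_wpM2l ?exprn_ge0 ?ler0n //.
by apply: ler_wiXn2l => //; lia.
Qed.

(** Grouping the pairs by a = |A|: the value a = 0 would force |B| = k + 1 and
    contributes nothing, and [rectangle_term_le] bounds the other k values. *)
Lemma rectangle_sum_le (R : realFieldType) (q : R) (k : nat) :
    0 <= q <= 1 -> k%:R ^+ 4 * q ^+ k.-1 <= 1 ->
  \sum_(A : {set 'I_k}) \sum_(B : {set 'I_k} | (#|A| + #|B|)%N == k.+1)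
      q ^+ (#|A| * #|B|) <= k%:R ^+ 2 * q ^+ k.
Proof.
move=> q01 small.
have card_lt (A : {set 'I_k}) : (#|A| < k.+1)%N.
  by have := max_card (mem A); rewrite card_ord.
pose F a := 'C(k, k.+1 - a)%:R * q ^+ (a * (k.+1 - a)).
have cardE m : #|[pred B : {set 'I_k} | #|B| == m]| = 'C(k, m).
  by rewrite -[in RHS](card_ord k) -card_draws cardsE.
rewrite (eq_bigr (fun A : {set 'I_k} => F #|A|)); last first.
  move=> A _; rewrite (eq_bigl [pred B : {set 'I_k} | #|B| == k.+1 - #|A|]%N);
    last first.
    by move=> B /=; rewrite -[RHS](eqn_add2l #|A|) subnKC // ltnW.
  rewrite (eq_bigr (fun=> q ^+ (#|A| * (k.+1 - #|A|)))) => [|B /eqP-> //].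
  by rewrite sumr_const cardE /F mulr_natl.
rewrite (partition_big (fun A : {set 'I_k} => Ordinal (card_lt A)) predT) //=.
rewrite (eq_bigr (fun a : 'I_k.+1 => 'C(k, a)%:R * F a)); last first.
  move=> a _; rewrite (eq_bigr (fun=> F a)) => [|A /eqP<- //].
  rewrite sumr_const mulr_natl; congr (_ *+ _).
  by rewrite -cardE; apply: eq_card => A.
rewrite big_ord_recl /F subn0 (bin_small (ltnSn k)) // mul0r mulr0 add0r.
apply: le_trans (_ : \sum_(i < k) k%:R * q ^+ k <= _).
  apply: ler_sum => i _; rewrite mulrA -natrM /=; apply: rectangle_term_le => //.
  - by rewrite /bump; have := ltn_ord i; lia.
  - by rewrite /bump; have := ltn_ord i; lia.
by rewrite sumr_const card_ord -[leLHS]mulr_natl mulrA -expr2.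
Qed.

(** * Random assignment of classes to colours *)

Lemma union_bound (T W : finType) (P : pred W) (bad : W -> {set T}) :
    (\sum_(w | P w) #|bad w| < #|T|)%N ->
  exists t, forall w, P w -> t \notin bad w.
Proof.
move=> lt_sum; have /card_gt0P[t] : (0 < #|~: \bigcup_(w | P w) bad w|)%N.
  rewrite cardsCs setCK subn_gt0; apply: leq_ltn_trans lt_sum.
  elim/big_rec2: _ => [|w m B _ leBm]; first by rewrite cards0.
  by apply: leq_trans (leq_card_setU _ _) _; rewrite leq_add2l.
rewrite inE => /bigcupP t_good; exists t => w Pw.
by apply/negP => tw; apply: t_good; exists w.
Qed.

(** The random choice of f. The set g v @: B stands for the colours of the list of
    v at the positions in B, so each side of the conclusion's rectangles is
    indexed by 'I_k, although the lists of different vertices may overlap. *)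
Lemma exists_transversal_colouring (R : realFieldType) (V W : finType)
    (r k : nat) (g : V -> 'I_k -> W) (part : V -> 'I_r) :
    let q := 1 - r%:R^-1 : R in
    (0 < r)%N -> (forall v, injective (g v)) ->
    k%:R ^+ 4 * q ^+ k.-1 <= 1 -> #|V|%:R * (k%:R ^+ 2 * q ^+ k) < 1 ->
  exists f : {ffun 'I_k * W -> 'I_r}, forall v (A B : {set 'I_k}),
    (#|A| + #|B| = k.+1)%N ->
    [exists i in A, exists j in B, f (i, g v j) == part v].
Proof.
move=> q r_gt0 g_inj small few.
have rR0 : 0 < r%:R :> R by rewrite ltr0n.
have q01 : 0 <= q <= 1.
  by rewrite subr_ge0 invf_le1 // ler1n r_gt0 gerBl invr_ge0 ltW.
pose rect (v : V) (A B : {set 'I_k}) := setX A (g v @: B).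
pose bad (w : V * ({set 'I_k} * {set 'I_k})) :=
  [set f : {ffun 'I_k * W -> 'I_r} |
    [forall x in rect w.1 w.2.1 w.2.2, f x != part w.1]].
pose P (w : V * ({set 'I_k} * {set 'I_k})) := (#|w.2.1| + #|w.2.2|)%N == k.+1.
have [|f f_good] := @union_bound _ _ P bad.
  rewrite -(ltr_nat R) natr_sum card_ffun card_ord natrX.
  rewrite (eq_bigr (fun w : V * ({set 'I_k} * {set 'I_k}) =>
      r%:R ^+ #|{: 'I_k * W}| * q ^+ (#|w.2.1| * #|w.2.2|))).
    rewrite -mulr_sumr -[ltRHS]mulr1 ltr_pM2l ?exprn_gt0 //.
    apply: le_lt_trans few.
    rewrite -(pair_big_dep predT
      (fun _ (u : {set 'I_k} * {set 'I_k}) => (#|u.1| + #|u.2|)%N == k.+1)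
      (fun _ (u : {set 'I_k} * {set 'I_k}) => q ^+ (#|u.1| * #|u.2|))) /=.
    rewrite sumr_const -[leLHS]mulr_natl ler_wpM2l ?ler0n //.
    rewrite -(pair_big_dep predT (fun A B : {set 'I_k} => (#|A| + #|B|)%N == k.+1)
      (fun A B => q ^+ (#|A| * #|B|))) /=.
    exact: rectangle_sum_le.
  by move=> w _; rewrite card_ffun_avoiding cardsX card_imset.
exists f => v A B /eqP cAB; have := f_good (v, (A, B)) cAB.
rewrite inE negb_forall => /existsP[[i c]]; rewrite negb_imply negbK /= inE /=.
move=> /andP[/andP[iA /imsetP[j jB ->]] fij].
by apply/exists_inP; exists i => //; apply/exists_inP; exists j.
Qed.

(** In the i-th colouring, a colour c is used only on the class f (i, c), which is
    independent; this gives properness. Disjointness holds because the matching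
    at each vertex is injective. *)
Lemma list_packable_of_colouring (R : realFieldType) (G : sgraph) (r k : nat)
    (part : G -> 'I_r) :
    let q := 1 - r%:R^-1 : R in
    (0 < r)%N -> (forall u v, edge u v -> part u != part v) ->
    k%:R ^+ 4 * q ^+ k.-1 <= 1 -> #|G|%:R * (k%:R ^+ 2 * q ^+ k) < 1 ->
  list_packable G k.
Proof.
move=> q r_gt0 proper small few L Lk.
(* The palette must be finite and common to all vertices. *)
pose N := \max_(v : G) \max_(c <- L v) c.
have L_le v c : c \in L v -> (c < N.+1)%N.
  move=> cL; rewrite ltnS; apply: leq_trans (leq_bigmax v).
  exact: (@leq_bigmax_seq _ (enum_fset (L v)) xpredT id c cL isT).
have nthL v (j : 'I_k) : nth 0%N (L v) j \in L v by rewrite mem_nth // Lk.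
pose g v (j : 'I_k) : 'I_N.+1 := inord (nth 0%N (L v) j).
have gE v j : g v j = nth 0%N (L v) j :> nat by rewrite inordK // (L_le v).
have g_inj v : injective (g v).
  move=> i j /(congr1 val) /=; rewrite !gE => /eqP.
  by rewrite nth_uniq ?fset_uniq ?Lk // => /eqP/val_inj.
have [f f_good] :=
    @exists_transversal_colouring R G _ r k g part r_gt0 g_inj small few.
have /fin_all_exists[s s_prop] : forall v, exists s : 'I_k -> 'I_k,
    injective s /\ forall i, f (i, g v (s i)) == part v.
  move=> v; have [s s_inj sE] := frobenius_konig (f_good v).
  by exists s.
exists (fun i v => g v (s v i)); split => [i|i j v neq_ij].
  split => [v|u v uv]; first by rewrite gE nthL.
  apply: contraNneq (proper u v uv) => /val_inj eq_g.
  by have [[_ /(_ i)/eqP<-] [_ /(_ i)/eqP<-]] := (s_prop u, s_prop v); rewrite eq_g.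
have [s_inj _] := s_prop v.
by rewrite val_eqE; apply: contra neq_ij => /eqP/g_inj/s_inj->.
Qed.

(** * Proper colourings from the Hall ratio *)

(** A largest independent set of the subgraph induced by U. *)
Lemma card_le_hall_ratio (R : realFieldType) (G : sgraph) (U : {set G}) :
  exists I : {set G}, [/\ I \subset U,
    forall u v, u \in I -> v \in I -> ~~ edge u v &
    #|U|%:R <= hall_ratio R G * #|I|%:R].
Proof.
have [->|U0] := eqVneq U set0.
  by exists set0; split; rewrite ?sub0set ?cards0 ?mulr0 // => u v; rewrite inE.
pose H : {set G} * {set G * G} :=
  (U, [set e | [&& e.1 \in U, e.2 \in U & edge e.1 e.2]]).
have subH : is_subgraph H.
  apply/forallP => x; apply/forallP => y; apply/implyP; rewrite !inE /=.
  by move=> /and3P[-> -> xy]; rewrite xy edge_sym xy.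
have ind0 : independent_in H set0.
  by rewrite /independent_in sub0set; apply/forall_inP => u; rewrite inE.
have [I indI alphaI] : {I | independent_in H I & alpha H = #|I|}.
  exact: (eq_bigmax_cond (fun I : {set G} => #|I|)
    (A := [pred I | independent_in H I]) (introT card_gt0P (ex_intro _ set0 ind0))).
exists I; case/andP: (indI) => IU /forall_inP noE; split => //.
  move=> u v uI vI; have /forall_inP/(_ v vI) := noE u uI.
  by rewrite inE /= (subsetP IU u) // (subsetP IU v).
(* Without this, |U| / |I| would be 0 and the ratio would give no information. *)
have I_gt0 : (0 < #|I|)%N.
  have /set0Pn[u uU] := U0; rewrite -alphaI.
  have ind1 : independent_in H [set u].
    rewrite /independent_in sub1set uU; apply/forall_inP => x /set1P->.
    by apply/forall_inP => y /set1P->; rewrite inE /= edge_irrefl !andbF.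
  by apply: leq_trans (leq_bigmax_cond _ ind1); rewrite cards1.
rewrite -ler_pdivrMr ?ltr0n // -alphaI.
by apply: (le_bigmax_cond 0 (j := H)
  (fun H : {set G} * {set G * G} => #|H.1|%:R / (alpha H)%:R)); rewrite subH.
Qed.

Lemma hall_ratio_ge1 (R : realFieldType) (G : sgraph) :
  (0 < #|G|)%N -> 1 <= hall_ratio R G.
Proof.
case/card_gt0P => v _; have [I [Iv _]] := card_le_hall_ratio R [set v].
rewrite cards1 => le1; have := subset_leq_card Iv; rewrite cards1.
case: #|I| le1 => [|[]] //; rewrite ?mulr0 ?mulr1 //.
by rewrite ler10.
Qed.

(** Giving a new colour to a largest independent set of the uncoloured part U
    shrinks U by a factor of at most 1 - 1/rho. *)
Lemma greedy_colouring (R : realFieldType) (G : sgraph) (t : nat) :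
    (0 < #|G|)%N ->
  exists (U : {set G}) (part : G -> nat),
    [/\ forall v, v \notin U -> (part v < t)%N,
        forall u v, u \notin U -> v \notin U -> edge u v -> part u != part v &
        #|U|%:R <= #|G|%:R * (1 - (hall_ratio R G)^-1) ^+ t].
Proof.
move=> G0; set rho := hall_ratio R G.
have rho1 : 1 <= rho := hall_ratio_ge1 R G0.
have rho0 : 0 < rho by apply: lt_le_trans rho1.
elim: t => [|t [U [part [part_lt part_neq leU]]]].
  exists setT, (fun=> 0%N); split; rewrite ?expr0 ?mulr1 ?cardsT //.
    by move=> v; rewrite inE.
  by move=> u v; rewrite inE.
have [I [IU indI leI]] := card_le_hall_ratio R U.
exists (U :\: I), (fun v => if v \in I then t else part v); split.
- move=> v; rewrite inE negb_and negbK; case: ifP => //= vI vU.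
  by rewrite ltnS ltnW // part_lt.
- move=> u v; rewrite !inE !negb_and !negbK.
  case: ifP => uI /=; case: ifP => vI //= uU vU uv.
  + by have := indI u v uI vI; rewrite uv.
  + by rewrite gtn_eqF // part_lt.
  + by rewrite ltn_eqF // part_lt.
  + exact: part_neq.
- rewrite cardsD (setIidPr IU) natrB ?subset_leq_card //.
  rewrite exprSr mulrA; apply: le_trans (ler_wpM2r _ leU); last first.
    by rewrite subr_ge0 invf_le1.
  by rewrite mulrBr mulr1 lerD2l lerN2 ler_pdivrMr // mulrC.
Qed.

Lemma one_sub_inv_expn_le (R : realType) (x : R) (m : nat) :
  1 <= x -> (1 - x^-1) ^+ m <= expR (- (m%:R / x)).
Proof.
move=> x1; have x0 : 0 < x by apply: lt_le_trans x1.
rewrite -mulrN expRM_natl lerXn2r ?nnegrE ?expR_ge0 //.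
  by rewrite subr_ge0 invf_le1.
exact: expR_ge1Dx.
Qed.

Lemma proper_colouring_hall_ratio (R : realType) (G : sgraph) (r : nat) :
    (0 < #|G|)%N -> hall_ratio R G * ln (#|G|%:R : R) < r%:R ->
  exists part : G -> 'I_r, forall u v, edge u v -> part u != part v.
Proof.
move=> G0 lt_r; have [U [part [part_lt part_neq leU]]] := greedy_colouring R r G0.
have rho1 := hall_ratio_ge1 R G0.
have rho0 : 0 < hall_ratio R G by apply: lt_le_trans rho1.
have GR0 : 0 < #|G|%:R :> R by rewrite ltr0n.
have U0 : U = set0.
  apply/eqP; rewrite -cards_eq0 -leqn0 -ltnS -(ltr_nat R).
  apply: le_lt_trans leU _.
  apply: le_lt_trans (ler_wpM2l (ler0n _ _) (one_sub_inv_expn_le _ rho1)) _.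
  have {1}-> : #|G|%:R = expR (ln #|G|%:R) :> R by rewrite lnK ?posrE.
  rewrite -expRD -[ltRHS]expR0 ltr_expR.
  by rewrite subr_lt0 ltr_pdivlMr // mulrC.
have part_lt' v : (part v < r)%N by apply: part_lt; rewrite U0 inE.
exists (fun v => Ordinal (part_lt' v)) => u v uv.
by rewrite -val_eqE /= part_neq // U0 inE.
Qed.

(** * The bound on the list packing number *)

(** The constant 16 is 2^4, from k^4 <= (2n)^4; the factor expR (l / 2) is what
    remains of n^(9/2) after absorbing n^4. *)
Lemma expR_half_ge16 (R : realType) (l : R) : 10 <= l -> 16 <= expR (l / 2).
Proof.
move=> l10; apply: le_trans (_ : expR (5%:R * 1) <= _).
  rewrite expRM_natl; apply: le_trans (_ : 2 ^+ 5 <= _).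
    by rewrite -natrX ler_nat.
  rewrite lerXn2r ?nnegrE ?expR_ge0 //.
  exact: (expR_ge1Dx (1 : R)).
by rewrite ler_expR mulr1; lra.
Qed.

(** The two hypotheses on k in [list_packable_of_colouring], with x = k, n = e^l
    and y = q^(k-1); the second is even obtained with q^(k-1) in place of q^k. *)
Lemma union_bound_conditions (R : realType) (l x y : R) :
    10 <= l -> 0 <= x -> x <= 2 * expR l -> 0 <= y -> y <= expR (- (9 / 2 * l)) ->
  x ^+ 4 * y <= 1 /\ expR l * (x ^+ 2 * y) < 1.
Proof.
move=> l10 x0 lex y0 ley; have exp_large := expR_half_ge16 l10.
have lexX m : x ^+ m * y <= 2 ^+ m * expR (m%:R * l - 9 / 2 * l).
  rewrite expRD expRM_natl mulrA -exprMn ler_pM ?exprn_ge0 //.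
  by rewrite lerXn2r // nnegrE mulr_ge0 ?expR_ge0.
split.
  apply: le_trans (lexX 4%N) _.
  have -> : 4%:R * l - 9 / 2 * l = - (l / 2) :> R by lra.
  by rewrite expRN ler_pdivrMr ?expR_gt0 // mul1r -natrX.
apply: le_lt_trans (ler_wpM2l (expR_ge0 l) (lexX 2%N)) _.
rewrite mulrCA -expRD.
have -> : l + (2%:R * l - 9 / 2 * l) = - (3 / 2 * l) :> R by lra.
rewrite expRN ltr_pdivrMr ?expR_gt0 // mul1r -natrX.
apply: lt_le_trans (_ : 16 <= _); first by rewrite ltr_nat.
by apply: le_trans exp_large _; rewrite ler_expR; lra.
Qed.

Theorem theorem6 (R : realType) (eps : R) (heps : 0 < eps) :
  exists n0 : nat, forall G : sgraph, (n0 <= #|G|)%N ->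
    (list_packing_number G)%:R
      <= (5 + eps) * hall_ratio R G * ln (#|G|%:R : R) ^+ 2.
Proof.
exists (Num.truncn (expR 10 : R)).+1 => G leG.
have G0 : (0 < #|G|)%N by apply: leq_trans leG.
have GR0 : 0 < #|G|%:R :> R by rewrite ltr0n.
set rho := hall_ratio R G; set l := ln _.
have rho1 : 1 <= rho := hall_ratio_ge1 R G0.
have GE : #|G|%:R = expR l :> R by rewrite lnK ?posrE.
have l10 : 10 <= l.
  rewrite -ler_expR -GE; apply: le_trans (ltW (truncnS_gt _)) _.
  by rewrite ler_nat.
have le_packing k : (0 < k)%N -> list_packable G k -> (list_packing_number G <= k)%N.
  move=> k0 packk; rewrite /list_packing_number; case: ex_minnP => m _; apply.
  by rewrite k0; apply/boolp.asboolP.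
suff [k [k0 packk lek]] : exists k, [/\ (0 < k)%N, list_packable G k &
    k%:R <= 5 * rho * l ^+ 2].
  apply: le_trans (_ : k%:R <= _); first by rewrite ler_nat le_packing.
  apply: le_trans lek _; rewrite ler_wpM2r ?sqr_ge0 // ler_wpM2r ?lerDl ?ltW //.
  exact: lt_le_trans rho1.
have l2_ge : 10 * l <= rho * l ^+ 2.
  rewrite expr2 mulrA ler_wpM2r ?(le_trans _ l10) //.
  by rewrite -[leLHS]mul1r ler_pM // (le_trans _ l10).
have X0 : 0 <= 5 * rho * l ^+ 2 by rewrite -mulrA; lra.
have [big|small] := leP (#|G|.*2.+1)%:R (5 * rho * l ^+ 2).
  by exists #|G|.*2.+1; split => //; apply: list_packable_large.
pose k := Num.truncn (5 * rho * l ^+ 2).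
have /andP[kle ltk] : k%:R <= 5 * rho * l ^+ 2 < k.+1%:R := truncn_itv X0.
have lek2 : k%:R <= 2 * expR l.
  rewrite -GE -natrM ler_nat mul2n -ltnS -(ltr_nat R).
  exact: le_lt_trans kle small.
pose r := (Num.truncn (rho * l)).+1.
have ltr : rho * l < r%:R := truncnS_gt _.
have ler : r%:R <= rho * l + 1.
  rewrite /r -natr1 lerD2r; have /truncn_itv/andP[] // : 0 <= rho * l.
  by rewrite mulr_ge0 // (le_trans _ l10, le_trans _ rho1).
have [part part_neq] := proper_colouring_hall_ratio G0 ltr.
have r1 : 1 <= r%:R :> R by rewrite ler1n.
have k1 : (1 < k)%N.
  rewrite -(ltr_nat R) -(ltrD2r 1) !natr1; apply: lt_trans ltk; rewrite -mulrA; lra.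
exists k; split => //; first exact: ltnW.
pose q : R := 1 - r%:R^-1.
have q01 : 0 <= q <= 1 by rewrite subr_ge0 invf_le1 ?gerBl ?invr_ge0 ?r1 //; lra.
(* Here (k - 1) / r is at least (5 rho l^2 - 2) / (rho l + 1), and lowering 5 to
   9/2 pays for the rounding in k and r as soon as l >= 10. *)
have q_small : q ^+ k.-1 <= expR (- (9 / 2 * l)).
  apply: le_trans (one_sub_inv_expn_le _ r1) _; rewrite ler_expR lerN2.
  rewrite ler_pdivlMr ?(lt_le_trans _ r1) //.
  have -> : k.-1%:R = k.+1%:R - 2 :> R
    by case: (k) k1 => // m _; rewrite -(addn2 m) natrD addrK.
  have : 9 / 2 * l * r%:R <= 9 / 2 * l * (rho * l + 1) by rewrite ler_wpM2l //; lra.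
  have -> : 9 / 2 * l * (rho * l + 1) = 9 / 2 * (rho * l ^+ 2) + 9 / 2 * l by ring.
  by move: ltk; rewrite -(mulrA 5); lra.
have q_ge0 : 0 <= q ^+ k.-1 by rewrite exprn_ge0 //; case/andP: q01.
have [small4 few] :=
  union_bound_conditions l10 (ler0n R k) lek2 q_ge0 q_small.
apply: (@list_packable_of_colouring R G r k part) => //.
rewrite GE; apply: le_lt_trans few.
rewrite ler_wpM2l ?expR_ge0 // ler_wpM2l ?exprn_ge0 ?ler0n //.
by case/andP: q01 => q0 q1; apply: ler_wiXn2l (leq_pred _).
Qed.
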